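(* Let $m\ge n\ge 2$ and let $f:\Omega\to\mathbb{R}^m$ be an orientation-preserving smooth embedding of a domain $\Omega\subset\mathbb{R}^n$ into $\mathbb{R}^m$. For $p\in\Omega$ put $$\lambda(p)=\left[\det\left(\mathbb{D}^t f(p)\,\mathbb{D}f(p)\right)\right]^{1/n}.$$ Then the following statements are equivalent: (a) $f$ is $1$-QC, i.e. for all $x\in\Omega$, $$\limsup_{r\to 0}\frac{\sup\{|f(x)-f(y)|: |x-y|=r\}}{\inf\{|f(x)-f(y)|: |x-y|=r\}}\le 1;$$ (b) for each $p\in\Omega$ and all unit vectors $e_1,e_2\in\mathbb{R}^n$, $\|\mathbb{D}f(p)e_1\|=\|\mathbb{D}f(p)e_2\|$; (c) for each $p\in\Omega$ and all $v_1,v_2\in\mathbb{R}^n$, $\langle \mathbb{D}f(p)v_1,\mathbb{D}f(p)v_2\rangle=\lambda(p)\langle v_1,v_2\rangle$; (d) $f$ is a solution to the equation $\mathbb{D}^tf(x)\,\mathbb{D}f(x)=\lambda(x)\,\mathbb{I}$ for $x\in\Omega$, where $\mathbb{I}$ is the $n\times n$ identity matrix.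
   Context: For a smooth map $f=(f_1,\dots,f_m):\Omega\to\mathbb{R}^m$ on a domain $\Omega\subset\mathbb{R}^n$ and $a\in\Omega$, $\mathbb{D}f(a)=\left(\frac{\partial f_j(a)}{\partial x_i}\right)$ is the $m\times n$ Jacobian matrix, regarded as a linear transformation from $\mathbb{R}^n$ to $\mathbb{R}^m$, and $\mathbb{D}^tf(a)$ is its transpose. The embedding $f$ is called orientation-preserving if $\det(\mathbb{D}^tf(a)\mathbb{D}f(a))>0$ for each $a\in\Omega$. Norms and inner products are Euclidean. *)

(* Defs.v *)
From HB Require Import structures.
From mathcomp Require Import all_boot all_order all_algebra.
From mathcomp Require Import all_classical all_reals all_analysis.
Import Order.TTheory GRing.Theory Num.Theory.
Import numFieldNormedType.Exports.

Set Implicit Arguments.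
Unset Strict Implicit.
Unset Printing Implicit Defensive.

Local Open Scope classical_set_scope.
Local Open Scope ring_scope.

(* R^n is 'cV[R]_n, so that a matrix A acts by v |-> A *m v.
   The library norm `|v| on matrices is the sup norm; it is used only through
   the topology it induces, which is the Euclidean one. *)

Definition dotp (R : realType) (n : nat) (u v : 'cV[R]_n) : R :=
  \sum_(i < n) u i 0 * v i 0.

Definition enorm (R : realType) (n : nat) (v : 'cV[R]_n) : R :=
  Num.sqrt (dotp v v).

(* A map on Omega is represented by a total function on R^n; all the notions
   below depend only on its values on the open set Omega. *)

Definition domain (R : realType) (n : nat) (Omega : set 'cV[R]_n) : Prop :=
  [/\ Omega !=set0, open Omega & connected Omega].

Definition partial (R : realType) (n : nat) (i : 'I_n) (g : 'cV[R]_n -> R) :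
    'cV[R]_n -> R :=
  fun a => 'D_(delta_mx i 0) g a.

Definition iter_partial (R : realType) (n : nat) (s : seq 'I_n)
    (g : 'cV[R]_n -> R) : 'cV[R]_n -> R :=
  foldr (@partial R n) g s.

(* The derivative operator 'D_v is total, so derivability is required
   separately at every order. *)
Definition smooth_fun (R : realType) (n : nat) (Omega : set 'cV[R]_n)
    (g : 'cV[R]_n -> R) : Prop :=
  forall (s : seq 'I_n) (a : 'cV[R]_n), Omega a ->
    {for a, continuous (iter_partial s g)} /\
    forall i : 'I_n, derivable (iter_partial s g) a (delta_mx i 0).

Definition comp_fun (R : realType) (n m : nat) (f : 'cV[R]_n -> 'cV[R]_m)
    (j : 'I_m) : 'cV[R]_n -> R :=
  fun x => f x j 0.

Definition smooth_map (R : realType) (n m : nat) (Omega : set 'cV[R]_n)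
    (f : 'cV[R]_n -> 'cV[R]_m) : Prop :=
  forall j : 'I_m, smooth_fun Omega (comp_fun f j).

(* The library's 'J is stated for row vectors and is the transpose of this. *)
Definition Dmx (R : realType) (n m : nat) (f : 'cV[R]_n -> 'cV[R]_m)
    (a : 'cV[R]_n) : 'M[R]_(m, n) :=
  \matrix_(j < m, i < n) partial i (comp_fun f j) a.

(* Smooth immersion that is a homeomorphism onto its image: the inverse g is
   continuous for the subspace topology of the image. *)
Definition smooth_embedding (R : realType) (n m : nat) (Omega : set 'cV[R]_n)
    (f : 'cV[R]_n -> 'cV[R]_m) : Prop :=
  [/\ smooth_map Omega f,
      forall a, Omega a -> \rank (Dmx f a) = n &
      exists g : 'cV[R]_m -> 'cV[R]_n,
        (forall x, Omega x -> g (f x) = x) /\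
        {within f @` Omega, continuous g}].

Definition orientation_preserving (R : realType) (n m : nat)
    (Omega : set 'cV[R]_n) (f : 'cV[R]_n -> 'cV[R]_m) : Prop :=
  forall a, Omega a -> 0 < \det ((Dmx f a)^T *m Dmx f a).

Definition lambda (R : realType) (n m : nat) (f : 'cV[R]_n -> 'cV[R]_m)
    (p : 'cV[R]_n) : R :=
  (\det ((Dmx f p)^T *m Dmx f p)) `^ (n%:R^-1).

Definition sphere_dists (R : realType) (n m : nat) (Omega : set 'cV[R]_n)
    (f : 'cV[R]_n -> 'cV[R]_m) (x : 'cV[R]_n) (r : R) : set (\bar R) :=
  [set (enorm (f x - f y))%:E | y in [set y | Omega y /\ enorm (x - y) = r]].

(* The quotient is taken in \bar R. For all small r > 0 the sphere lies in
   Omega and, when 0 < n and f is continuous and injective, the supremum and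
   the infimum are positive reals, so the conventions for degenerate quotients
   do not affect the limsup. *)
Definition dilatation (R : realType) (n m : nat) (Omega : set 'cV[R]_n)
    (f : 'cV[R]_n -> 'cV[R]_m) (x : 'cV[R]_n) (r : R) : \bar R :=
  (ereal_sup (sphere_dists Omega f x r) /
   ereal_inf (sphere_dists Omega f x r))%E.

Definition QC (R : realType) (n m : nat) (K : R) (Omega : set 'cV[R]_n)
    (f : 'cV[R]_n -> 'cV[R]_m) : Prop :=
  forall x, Omega x ->
    (limf_esup (dilatation Omega f x) (0 : R)^'+ <= K%:E)%E.

(* Main.v *)
Require Import Defs.
From HB Require Import structures.
From mathcomp Require Import all_boot all_order all_algebra.
From mathcomp Require Import all_classical all_reals all_analysis.
From mathcomp Require Import ring lra.
Import Order.TTheory GRing.Theory Num.Theory.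
Import numFieldNormedType.Exports.

Local Open Scope classical_set_scope.
Local Open Scope ring_scope.

(** A smooth map is, to first order at each point [a], its linear part [Dmx f a]:
for every [e > 0] the error [f (a + h) - f a - Dmx f a *m h] has Euclidean norm
at most [e * enorm h] once [h] is small ([smooth_map_increment]).  Hence the
image of a small sphere of radius [r] around [a] lies, up to [e * r], at the
distances from [f a] that the linear map [Dmx f a] prescribes, and the limit
superior of the dilatation only sees the ratio between the largest and the
smallest value of [enorm (Dmx f a *m e)] over unit vectors [e].

(a) to (b): if [enorm (Dmx f p *m e2) < enorm (Dmx f p *m e1)], comparing the two
points [p + r *: e1] and [p + r *: e2] bounds the dilatation below by a constant
[q > 1] for all small [r].

(b) to (c): by homogeneity the linear map multiplies all norms by one factor
[s]; polarization turns this into [dotp (A *m u) (A *m v) = s ^+ 2 * dotp u v], so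
the Gram matrix is [s ^+ 2 *: 1%:M], and taking determinants identifies [s ^+ 2]
with [lambda f p].

(c) to (d): evaluate on the canonical basis.

(d) to (a): the linear map multiplies norms by [Num.sqrt (lambda f x)], which is
positive, so the distances on a small sphere lie between [r * (s - eps)] and
[r * (s + eps)], whose ratio is as close to 1 as desired.

First-order approximation is derived from the continuity of the partial
derivatives alone: the increment is telescoped along the coordinate directions,
and the mean value theorem is applied to each of them. *)

(** * The Euclidean inner product and norm *)

Section Euclidean.
Context {R : realType} {n : nat}.
Implicit Types (u v w : 'cV[R]_n) (c : R).

Lemma dotpE u v : u^T *m v = (dotp u v)%:M.
Proof.
apply/matrixP => i j; rewrite !ord1 !mxE /dotp eqxx mulr1n.
by apply: eq_bigr => k _; rewrite mxE.
Qed.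

Lemma dotpC u v : dotp u v = dotp v u.
Proof. by apply: eq_bigr => i _; rewrite mulrC. Qed.

Lemma dotpDl u v w : dotp (u + v) w = dotp u w + dotp v w.
Proof. by rewrite -big_split; apply: eq_bigr => i _; rewrite mxE mulrDl. Qed.

Lemma dotpZl c u v : dotp (c *: u) v = c * dotp u v.
Proof. by rewrite /dotp mulr_sumr; apply: eq_bigr => i _; rewrite mxE mulrA. Qed.

Lemma dotpDr u v w : dotp u (v + w) = dotp u v + dotp u w.
Proof. by rewrite dotpC dotpDl !(dotpC u). Qed.

Lemma dotpZr c u v : dotp u (c *: v) = c * dotp u v.
Proof. by rewrite dotpC dotpZl dotpC. Qed.

Lemma dotp_ge0 u : 0 <= dotp u u.
Proof. by apply: sumr_ge0 => i _; rewrite -expr2 sqr_ge0. Qed.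

Lemma dotp_eq0 u : dotp u u = 0 -> u = 0.
Proof.
move=> /eqP; rewrite psumr_eq0 => [/allP u0|i _]; last by rewrite -expr2 sqr_ge0.
apply/matrixP => i j; rewrite ord1 mxE.
by have := u0 i; rewrite mem_index_enum mulf_eq0 orbb => /(_ isT)/eqP.
Qed.

Lemma dotp_delta u (i : 'I_n) : dotp u (delta_mx i 0) = u i 0.
Proof.
rewrite /dotp (bigD1 i) //= mxE !eqxx mulr1 big1 ?addr0 // => j /negPf ji.
by rewrite mxE ji mulr0.
Qed.

Lemma enorm_ge0 u : 0 <= enorm u.
Proof. exact: sqrtr_ge0. Qed.

Lemma enorm_sqr u : enorm u ^+ 2 = dotp u u.
Proof. by rewrite sqr_sqrtr ?dotp_ge0. Qed.

Lemma enorm0 : enorm (0 : 'cV[R]_n) = 0.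
Proof. by rewrite /enorm -(scale0r 0) dotpZl mul0r sqrtr0. Qed.

Lemma enorm_eq0 u : enorm u = 0 -> u = 0.
Proof. by move=> u0; apply: dotp_eq0; rewrite -enorm_sqr u0 expr0n. Qed.

Lemma enormZ c u : enorm (c *: u) = `|c| * enorm u.
Proof.
by rewrite /enorm dotpZl dotpZr mulrA -expr2 sqrtrM ?sqr_ge0 // sqrtr_sqr.
Qed.

Lemma enormN u : enorm (- u) = enorm u.
Proof. by rewrite -scaleN1r enormZ normrN1 mul1r. Qed.

Lemma enorm_delta (i : 'I_n) : enorm (delta_mx i 0 : 'cV[R]_n) = 1.
Proof. by rewrite /enorm dotp_delta mxE !eqxx sqrtr1. Qed.

(** Cauchy-Schwarz, from the nonnegativity of the squared norm of
[enorm v *: u - enorm u *: v]. *)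
Lemma dotp_le_enorm u v : dotp u v <= enorm u * enorm v.
Proof.
have [/eqP/enorm_eq0->|u0] := boolP (enorm u == 0).
  by rewrite -(scale0r 0) dotpZl enormZ normr0 !mul0r.
have [/eqP/enorm_eq0->|v0] := boolP (enorm v == 0).
  by rewrite -(scale0r 0) dotpZr enormZ normr0 !mul0r mulr0.
have up : 0 < enorm u by rewrite lt_def u0 enorm_ge0.
have vp : 0 < enorm v by rewrite lt_def v0 enorm_ge0.
have := dotp_ge0 (enorm v *: u + (- enorm u) *: v).
rewrite !(dotpDl, dotpDr, dotpZl, dotpZr) (dotpC v u) -!enorm_sqr => h.
have {h} : 0 <= 2 * (enorm u * enorm v) * (enorm u * enorm v - dotp u v) by lra.
by rewrite pmulr_rge0 ?subr_ge0 // mulr_gt0 ?mulr_gt0.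
Qed.

Lemma enormD u v : enorm (u + v) <= enorm u + enorm v.
Proof.
rewrite -(ler_pXn2r (n := 2)) ?nnegrE ?addr_ge0 ?enorm_ge0 //.
rewrite enorm_sqr !(dotpDl, dotpDr) (dotpC v u) sqrrD -!enorm_sqr.
have := dotp_le_enorm u v; lra.
Qed.

Lemma enorm_dist u v : `|enorm u - enorm v| <= enorm (u - v).
Proof.
have le (x y : 'cV[R]_n) : enorm x - enorm y <= enorm (x - y).
  by rewrite lerBlDr (le_trans _ (enormD _ _)) ?subrK.
by rewrite ler_norml le andbT lerNl opprB -(enormN (u - v)) opprB le.
Qed.

Lemma coord_le_enorm u (i : 'I_n) : `|u i 0| <= enorm u.
Proof.
rewrite -sqrtr_sqr ler_wsqrtr // /dotp (bigD1 i) //= -expr2 lerDl.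
by apply: sumr_ge0 => j _; rewrite -expr2 sqr_ge0.
Qed.

Lemma enorm_le_coord u (e : R) :
  (forall i, `|u i 0| <= e) -> enorm u <= n%:R * e.
Proof.
(* A negative bound forces n = 0, and both sides vanish. *)
move=> ue; have [e0|e0] := leP 0 e; last first.
  have n0 : forall i : 'I_n, False.
    by move=> i; have := le_lt_trans (ue i) e0; rewrite normr_lt0.
  rewrite /enorm /dotp big1 => [|i]; last by have := n0 i.
  by case: n n0 => [|k /(_ ord0)]; rewrite ?sqrtr0 ?mul0r.
rewrite -(ler_pXn2r (n := 2)) ?nnegrE ?enorm_ge0 ?mulr_ge0 //.
rewrite enorm_sqr (@le_trans _ _ (\sum_(i < n) e ^+ 2)) //.
  by apply: ler_sum => i _; rewrite -expr2 -real_normK ?num_real //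
     ler_pXn2r ?nnegrE.
rewrite sumr_const card_ord -[leLHS]mulr_natl exprMn ler_wpM2r ?sqr_ge0 //.
by case: n => [|k]; rewrite ?expr0n // expr2 ler_peMr // ler1n.
Qed.

(** The norm on the left is the sup norm of matrices. *)
Lemma mx_norm_le_enorm u : `|u| <= enorm u.
Proof.
rewrite /Num.Def.normr /= mx_normrE; apply: bigmax_le => [|[i j] _ /=].
  exact: enorm_ge0.
by rewrite ord1 coord_le_enorm.
Qed.

End Euclidean.

Lemma dotp_mulmx {R : realType} {m n : nat} (A : 'M[R]_(m, n))
  (u v : 'cV[R]_n) : dotp (A *m u) (A *m v) = dotp u (A^T *m A *m v).
Proof.
have := dotpE (A *m u) (A *m v).
rewrite -[(A^T *m A) *m v]mulmxA trmx_mul -[_ *m A^T *m _]mulmxA dotpE.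
by move=> /(congr1 (fun M : 'M[R]_1 => M 0 0)); rewrite !mxE eqxx !mulr1n.
Qed.

(** * First-order approximation by the Jacobian matrix *)

Section Increments.
Context {R : realType}.

(** Mean value inequality for [phi] minus the linear function of slope [c], for
an increment [h] of either sign. *)
Lemma increment_bound (phi dphi : R -> R) (c e h : R) :
  (forall t : R, `|t| <= `|h| -> is_derive t (1 : R) phi (dphi t)) ->
  (forall t, `|t| <= `|h| -> `|dphi t - c| <= e) ->
  `|phi h - phi 0 - h * c| <= e * `|h|.
Proof.
move=> phid dphic.
have [t th ->] : exists2 t, `|t| <= `|h| & phi h - phi 0 = dphi t * h.
  have mvt (a b : R) : a <= b -> (forall t, a <= t <= b -> `|t| <= `|h|) ->
      exists2 t, `|t| <= `|h| & phi b - phi a = dphi t * (b - a).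
    move=> ab abh; have [||t] := @MVT_segment R phi dphi a b ab.
    - move=> x; rewrite in_itv /= => /andP[/ltW ax /ltW xb].
      by apply: phid; apply: abh; rewrite ax.
    - apply: derivable_within_continuous => x; rewrite in_itv /= => /abh/phid.
      by move=> [].
    - by rewrite in_itv /= => /abh th ->; exists t.
  have [h0|h0] := leP 0 h.
    have [t /andP[t0 th]|t th ->] := mvt 0 h h0; first by rewrite !ger0_norm.
    by exists t => //; rewrite subr0.
  have [t /andP[th t0]|t th E] := mvt h 0 (ltW h0).
    by rewrite !ler0_norm ?lerN2 // ltW.
  by exists t => //; rewrite -opprB E sub0r mulrN opprK.
by rewrite mulrC -mulrBr normrM mulrC ler_wpM2r ?dphic.
Qed.

Context {n : nat}.
Implicit Types (g : 'cV[R]_n -> R) (a b h : 'cV[R]_n).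

Lemma is_derive_along g b (v : 'cV[R]_n) (t : R) :
  derivable g (b + t *: v) v ->
  is_derive t (1 : R) (fun s : R => g (b + s *: v)) ('D_v g (b + t *: v)).
Proof.
have E : (fun k : R => k^-1 *: (((fun s : R => g (b + s *: v)) \o shift t)
             (k *: (1 : R)) - g (b + t *: v))) =
         (fun k : R => k^-1 *: ((g \o shift (b + t *: v)) (k *: v)
             - g (b + t *: v))).
  apply/funext => k /=; congr (_ *: (g _ - _)).
  by rewrite -[k *: 1]/(k * 1) mulr1 scalerDl addrCA.
by move=> dg; apply: DeriveDef; rewrite /derivable /derive E.
Qed.

(** The vector [h] with all but its first [k] coordinates replaced by 0.  These
vectors are the vertices of a path from 0 to [h] parallel to the axes. *)
Definition trunc (k : nat) (h : 'cV[R]_n) : 'cV[R]_n :=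
  \col_i (if (i < k)%N then h i 0 else 0).

Lemma trunc0 h : trunc 0 h = 0.
Proof. by apply/matrixP => i j; rewrite !mxE. Qed.

Lemma trunc_full h : trunc n h = h.
Proof. by apply/matrixP => i j; rewrite ord1 !mxE ltn_ord. Qed.

Lemma truncS h (k : 'I_n) :
  trunc k.+1 h = trunc k h + h k 0 *: delta_mx k 0.
Proof.
apply/matrixP => i j; rewrite ord1 !mxE eqxx andbT ltnS leq_eqVlt.
have [/eqP/val_inj->|ik] := boolP (i == k :> nat).
  by rewrite ltnn eqxx mulr1 add0r.
suff /negPf-> : i != k by rewrite mulr0 addr0.
by apply: contra ik => /eqP->.
Qed.

Lemma coord_le_norm h (i : 'I_n) : `|h i 0| <= `|h|.
Proof.
rewrite [leRHS]/Num.Def.normr /= mx_normrE.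
by rewrite (le_bigmax _ (fun ij : 'I_n * 'I_1 => `|h ij.1 ij.2|) (i, 0)).
Qed.

(** Every edge of that path stays in the sup-norm ball of radius [`|h|]. *)
Lemma norm_trunc h (k : 'I_n) (t : R) :
  `|t| <= `|h k 0| -> `|trunc k h + t *: delta_mx k 0| <= `|h|.
Proof.
move=> th.
rewrite [leLHS]/Num.Def.normr /= mx_normrE; apply: bigmax_le => // -[i j] _ /=.
rewrite ord1 !mxE eqxx andbT.
have [->|ik] := eqVneq i k; first
  by rewrite ltnn add0r mulr1 (le_trans th) ?coord_le_norm.
by rewrite mulr0 addr0; case: ifP => _; rewrite ?normr0 ?coord_le_norm.
Qed.

(** If the partial derivatives differ by at most [e] from their values at [a] on the sup-norm ball of radius
[`|h|] around [a], then [g] is linear there up to an error proportional to [e]. *)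
Lemma increment_partial g a (e : R) h : 0 <= e ->
  (forall (i : 'I_n) b, `|b| <= `|h| -> derivable g (a + b) (delta_mx i 0)) ->
  (forall (i : 'I_n) b, `|b| <= `|h| ->
     `|partial i g (a + b) - partial i g a| <= e) ->
  `|g (a + h) - g a - \sum_(i < n) h i 0 * partial i g a|
    <= n%:R * e * `|h|.
Proof.
move=> e0 dg pg.
have -> : g (a + h) - g a = 
   \sum_(i < n) (g (a + trunc i.+1 h) - g (a + trunc i h)).
  rewrite -(big_mkord xpredT (fun i => g (a + trunc i.+1 h) - g (a + trunc i h))).
  by rewrite telescope_sumr // trunc_full trunc0 addr0.
rewrite -sumrB (le_trans (ler_norm_sum _ _ _)) //.
rewrite (@le_trans _ _ (\sum_(i < n) e * `|h|)) //; last first.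
  by rewrite sumr_const card_ord -[leLHS]mulr_natl mulrA.
apply: ler_sum => i _.
pose p : 'cV[R]_n := delta_mx i 0.
have tr t : `|t| <= `|h i 0| -> `|trunc i h + t *: p| <= `|h|.
  exact: norm_trunc.
have := @increment_bound (fun t => g (a + trunc i h + t *: p))
  (fun t => 'D_p g (a + trunc i h + t *: p)) (partial i g a) e (h i 0).
rewrite scale0r addr0 -[_ + _ + h i 0 *: p]addrA -truncS => H.
apply: (le_trans (H _ _)).
- by move=> t /tr th; apply: is_derive_along; rewrite -addrA; exact: dg.
- by move=> t /tr th; rewrite -addrA; exact: pg.
- by rewrite ler_wpM2l // coord_le_norm.
Qed.

End Increments.

(** Total differentiability of a smooth map, in the Euclidean norms. *)
Lemma smooth_map_increment {R : realType} {n m : nat} (Omega : set 'cV[R]_n)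
    (f : 'cV[R]_n -> 'cV[R]_m) (a : 'cV[R]_n) (e : R) :
  open Omega -> smooth_map Omega f -> Omega a -> 0 < e ->
  exists2 d : R, 0 < d & forall h, enorm h < d ->
    Omega (a + h) /\ enorm (f (a + h) - f a - Dmx f a *m h) <= e * enorm h.
Proof.
move=> oO fs Oa e0.
(* The factors m and n come from enorm_le_coord and increment_partial; the
   summand 1 keeps the denominator positive when m or n is 0. *)
pose e' := e / (m%:R * n%:R + 1).
have mn0 : 0 < m%:R * n%:R + 1 :> R by rewrite ltr_wpDl // mulr_ge0.
have e'0 : 0 < e' by rewrite divr_gt0.
have : \forall b \near a, Omega b /\ forall j i,
    `|partial i (comp_fun f j) b - partial i (comp_fun f j) a| <= e'.
  near=> b; split; first by near: b; exact: (open_nbhs_nbhs (conj oO Oa)).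
  near: b; apply: filter_forall => j; apply: filter_forall => i.
  have [+ _] := fs j [:: i] a Oa.
  by move=> /cvgrPdistC_le; apply.
move=> /nbhs_normP[d /= d0 ball_d]; exists d => // h hd.
have good b : `|b| <= `|h| -> Omega (a + b) /\ forall j i,
    `|partial i (comp_fun f j) (a + b) - partial i (comp_fun f j) a| <= e'.
  move=> bh; apply: ball_d; rewrite /= opprD addrA subrr sub0r normrN.
  by rewrite (le_lt_trans bh) // (le_lt_trans _ hd) // mx_norm_le_enorm.
split; first by have [] := good h (lexx _).
have mne : m%:R * (n%:R * e') <= e.
  rewrite mulrA /e' mulrCA ler_piMr ?(ltW e0) // ler_pdivrMr // mul1r.
  by rewrite lerDl.
have le_e : m%:R * (n%:R * e' * `|h|) <= e * enorm h.
  rewrite mulrA; apply: ler_pM mne _ => //; last exact: mx_norm_le_enorm.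
  by apply: mulr_ge0 => //; apply: mulr_ge0 => //; exact: ltW.
apply: le_trans le_e; apply: enorm_le_coord => j.
rewrite !mxE (eq_bigr (fun i => h i 0 * partial i (comp_fun f j) a)); last first.
  by move=> i _; rewrite mxE mulrC.
apply: (@increment_partial R n (comp_fun f j)); first exact: ltW.
- by move=> i b /good[Ob _]; have [_] := fs j [::] _ Ob; apply.
- by move=> i b /good[_]; apply.
Unshelve. all: by end_near. Qed.

(** Distances from [f a] are, to first order, the norms prescribed by the
Jacobian matrix. *)
Lemma smooth_map_enorm_increment {R : realType} {n m : nat}
    (Omega : set 'cV[R]_n) (f : 'cV[R]_n -> 'cV[R]_m) (a : 'cV[R]_n) (e : R) :
  open Omega -> smooth_map Omega f -> Omega a -> 0 < e ->
  exists2 d : R, 0 < d & forall h, enorm h < d ->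
    Omega (a + h) /\
    `|enorm (f a - f (a + h)) - enorm (Dmx f a *m h)| <= e * enorm h.
Proof.
move=> oO fs Oa e0; have [d d0 fd] := smooth_map_increment _ _ _ _ oO fs Oa e0.
exists d => // h /fd[Oah fh]; split=> //; apply: le_trans fh.
rewrite -(enormN (f a - _)) opprB; set u := _ - f a; set v := _ *m h.
exact: enorm_dist.
Qed.

(** * Limits superior and the dilatation *)

Section LimSup.
Context {R : realType} {T : choiceType} {X : filteredType T}.
Context (F : set_system X) {FF : ProperFilter F}.
Implicit Types (u : X -> \bar R) (q : \bar R).

Lemma limf_esup_ge_near u q :
  (\forall x \near F, (q <= u x)%E) -> (q <= limf_esup u F)%E.
Proof.
move=> qu; rewrite limf_esupE; apply: le_ereal_inf_tmp => _ [V FV <-].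
have [x [Vx qx]] := filter_ex (filterI FV qu).
by rewrite (le_trans qx) //; apply: ereal_sup_ubound; exists x.
Qed.

Lemma limf_esup_le_near u q :
  (\forall x \near F, (u x <= q)%E) -> (limf_esup u F <= q)%E.
Proof.
move=> uq; rewrite limf_esupE.
apply: (@le_trans _ _ (ereal_sup (u @` [set x | (u x <= q)%E]))).
  by apply: ereal_inf_lbound; exists [set x | (u x <= q)%E].
by apply: ge_ereal_sup => _ [x xq <-].
Qed.

End LimSup.

(** The case [z = 0] or [t = 0] is covered, since the inverse of 0 is [+oo]. *)
Lemma lee_div {R : realType} (x y z t : \bar R) :
  (0 <= x -> 0 <= t -> x <= y -> t <= z -> x / z <= y / t)%E.
Proof.
move=> x0 t0 xy tz.
apply: lee_pmul => //; first by rewrite inve_ge0 (le_trans t0).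
by rewrite lee_pV2 // inE (le_trans t0).
Qed.

Lemma sphere_dists_translate {R : realType} {n m : nat} (Omega : set 'cV[R]_n)
    (f : 'cV[R]_n -> 'cV[R]_m) (x e : 'cV[R]_n) (r : R) :
  0 <= r -> enorm e = 1 -> Omega (x + r *: e) ->
  sphere_dists Omega f x r (enorm (f x - f (x + r *: e)))%:E.
Proof.
move=> r0 e1 Oy; exists (x + r *: e) => //; split=> //.
by rewrite opprD addrA subrr sub0r enormN enormZ e1 mulr1 ger0_norm.
Qed.

Section Dilatation.
Context {R : realType} {n m : nat} (Omega : set 'cV[R]_n).
Context (f : 'cV[R]_n -> 'cV[R]_m) (x : 'cV[R]_n) (r : R).

Lemma sphere_dists_ge0 s : sphere_dists Omega f x r s -> (0 <= s)%E.
Proof. by move=> [y _ <-]; rewrite lee_fin enorm_ge0. Qed.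

(** The infimum may be 0 here: the quotient is then [+oo] unless the supremum is 0
as well, in which case [q] is 0 and so is the quotient. *)
Lemma dilatation_ge (s1 s2 q : R) : 0 <= q -> 0 < s2 -> q * s2 <= s1 ->
  sphere_dists Omega f x r s1%:E ->
  (exists2 s, sphere_dists Omega f x r s & (s <= s2%:E)%E) ->
  (q%:E <= dilatation Omega f x r)%E.
Proof.
move=> q0 s20 qs S1 [s Ss ss2].
have -> : (q%:E = (q * s2)%:E / s2%:E)%E.
  by rewrite inver gt_eqF // -EFinM mulfK ?gt_eqF.
apply: lee_div; first by rewrite lee_fin mulr_ge0 // ltW.
- by apply: le_ereal_inf_tmp => t /sphere_dists_ge0.
- by apply: le_trans (ereal_sup_ubound S1); rewrite lee_fin.
- by apply: le_trans ss2; exact: ereal_inf_lbound.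
Qed.

Lemma dilatation_le (s q : R) : 0 < s -> sphere_dists Omega f x r !=set0 ->
  (forall t, sphere_dists Omega f x r t -> (s%:E <= t <= (q * s)%:E)%E) ->
  (dilatation Omega f x r <= q%:E)%E.
Proof.
move=> s0 [t0 St0] St.
have -> : (q%:E = (q * s)%:E / s%:E)%E.
  by rewrite inver gt_eqF // -EFinM mulfK ?gt_eqF.
apply: lee_div.
- by apply: le_trans (ereal_sup_ubound St0); exact: sphere_dists_ge0 St0.
- by rewrite lee_fin ltW.
- by apply: ge_ereal_sup => t /St/andP[].
- by apply: le_ereal_inf_tmp => t /St/andP[].
Qed.

End Dilatation.

(** * Linear maps with constant stretching *)

Section Similarity.
Context {R : realType} {m n : nat} (A : 'M[R]_(m, n)).

Lemma enorm_mulmx_homog (s : R) :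
  (forall e, enorm e = 1 -> enorm (A *m e) = s) ->
  forall v, enorm (A *m v) = s * enorm v.
Proof.
move=> As v; have [/eqP v0|v0] := boolP (enorm v == 0).
  by rewrite v0 (enorm_eq0 _ v0) mulmx0 enorm0 mulr0.
rewrite -(As ((enorm v)^-1 *: v)); last first.
  by rewrite enormZ ger0_norm ?invr_ge0 ?enorm_ge0 // mulVf.
by rewrite -scalemxAr enormZ ger0_norm ?invr_ge0 ?enorm_ge0 // mulrC mulVKf.
Qed.

Lemma dotp_mulmx_polar (s : R) :
  (forall v, enorm (A *m v) = s * enorm v) ->
  forall u v, dotp (A *m u) (A *m v) = s ^+ 2 * dotp u v.
Proof.
move=> As u v.
have sq w : dotp (A *m w) (A *m w) = s ^+ 2 * dotp w w.
  by rewrite -!enorm_sqr As exprMn.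
have := sq (u + v); rewrite mulmxDr !(dotpDl, dotpDr) !sq.
rewrite (dotpC v u) (dotpC (A *m v) (A *m u)); lra.
Qed.

Lemma gram_scalar (c : R) :
  (forall u v, dotp (A *m u) (A *m v) = c * dotp u v) ->
  A^T *m A = c *: 1%:M.
Proof.
move=> Ac; apply/matrixP => i j.
have := Ac (delta_mx i 0) (delta_mx j 0).
rewrite dotp_mulmx dotpC dotp_delta dotp_delta -colE !mxE => ->.
by rewrite eqxx andbT eq_sym.
Qed.

Lemma enorm_gram_scalar (c : R) : 0 <= c -> A^T *m A = c *: 1%:M ->
  forall v, enorm (A *m v) = Num.sqrt c * enorm v.
Proof.
move=> c0 Ac v.
by rewrite /enorm dotp_mulmx Ac -scalemxAl mul1mx dotpZr sqrtrM.
Qed.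

End Similarity.

(** The determinant of [c *: 1%:M] is [c ^+ n], whose [n]-th root is [c]. *)
Lemma lambda_gram_scalar {R : realType} {n m : nat}
    (f : 'cV[R]_n -> 'cV[R]_m) (p : 'cV[R]_n) (c : R) :
  (0 < n)%N -> 0 <= c -> (Dmx f p)^T *m Dmx f p = c *: 1%:M -> lambda f p = c.
Proof.
move=> n0 c0 Ac; rewrite /lambda Ac scalemx1 det_scalar -powR_mulrn //.
by rewrite -powRrM mulfV ?powRr1 // pnatr_eq0 -lt0n.
Qed.

(** * The equivalence *)

Theorem theorem2p1 (R : realType) (n m : nat) (hn : (2 <= n)%N)
    (hnm : (n <= m)%N) (Omega : set 'cV[R]_n) (f : 'cV[R]_n -> 'cV[R]_m)
    (hOmega : domain Omega) (hf : smooth_embedding Omega f)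
    (hop : orientation_preserving Omega f) :
  [<-> QC 1 Omega f;
       forall p, Omega p -> forall e1 e2 : 'cV[R]_n,
         enorm e1 = 1 -> enorm e2 = 1 ->
         enorm (Dmx f p *m e1) = enorm (Dmx f p *m e2);
       forall p, Omega p -> forall v1 v2 : 'cV[R]_n,
         dotp (Dmx f p *m v1) (Dmx f p *m v2) = lambda f p * dotp v1 v2;
       forall x, Omega x ->
         (Dmx f x)^T *m Dmx f x = lambda f x *: 1%:M].
Proof.
have [_ oO _] := hOmega; have [fs _ _] := hf.
have n0 : (0 < n)%N by exact: ltnW.
pose k0 := Ordinal n0.
tfae.
- move=> fQC p Op.
  (* By symmetry one inequality suffices. *)
  suff le e1 e2 : enorm e1 = 1 -> enorm e2 = 1 ->
      enorm (Dmx f p *m e1) <= enorm (Dmx f p *m e2).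
    by move=> e1 e2 e11 e21; apply/eqP; rewrite eq_le !le.
  move=> e11 e21; rewrite leNgt; apply/negP.
  set A := enorm (_ *m e1); set B := enorm (_ *m e2) => BA.
  have B0 : 0 <= B by exact: enorm_ge0.
  (* Small enough for B + eps < A - eps. *)
  pose eps := (A - B) / 3.
  have eps0 : 0 < eps by rewrite /eps; lra.
  have Beps0 : 0 < B + eps by lra.
  pose q := (A - eps) / (B + eps).
  have q1 : 1 < q by rewrite /q ltr_pdivlMr // mul1r /eps; lra.
  have [d d0 fd] := smooth_map_enorm_increment _ _ _ _ oO fs Op eps0.
  suff : (q%:E <= 1%:E)%E by rewrite lee_fin leNgt q1.
  apply: le_trans (fQC p Op); apply: limf_esup_ge_near.
  near=> r.
  have r0 : 0 < r by [].
  have rd (e : 'cV[R]_n) : enorm e = 1 -> enorm (r *: e) < d.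
    by move=> e1_; rewrite enormZ e1_ mulr1 gtr0_norm.
  have [Oy1 fy1] := fd _ (rd _ e11).
  have [Oy2 fy2] := fd _ (rd _ e21).
  move: fy1 fy2; rewrite -!scalemxAr !enormZ e11 e21 mulr1 (gtr0_norm r0).
  rewrite -/A -/B !ler_distl => /andP[fy1 _] /andP[_ fy2].
  apply: (@dilatation_ge _ _ _ _ _ _ _ (enorm (f p - f (p + r *: e1)))
            (r * (B + eps))).
  + by rewrite ltW // (lt_trans _ q1).
  + by rewrite mulr_gt0.
  + by rewrite mulrCA /q divfK ?gt_eqF // mulrBr [r * eps]mulrC.
  + by apply: sphere_dists_translate => //; exact: ltW.
  + exists (enorm (f p - f (p + r *: e2)))%:E; last first.
      by rewrite lee_fin mulrDr [r * eps]mulrC.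
    by apply: sphere_dists_translate => //; exact: ltW.
- move=> fb p Op.
  have As := enorm_mulmx_homog _ _ (fun e e1 => fb p Op e _ e1 (enorm_delta k0)).
  have Ac := dotp_mulmx_polar _ _ As.
  by rewrite (lambda_gram_scalar _ _ _ n0 _ (gram_scalar _ _ Ac)) // sqr_ge0.
- by move=> fc x Ox; apply: gram_scalar; exact: fc.
- move=> fd x Ox; set l := lambda f x.
  have l0 : 0 < l by rewrite powR_gt0 // hop.
  pose s := Num.sqrt l.
  have s0 : 0 < s by rewrite sqrtr_gt0.
  have As := enorm_gram_scalar _ _ (ltW l0) (fd x Ox); rewrite -/s in As.
  apply/lee_addgt0Pr => e e0.
  (* Chosen so that (s + eps) / (s - eps) = 1 + e. *)
  pose eps := s * e / (e + 2).
  have e20 : 0 < e + 2 by lra.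
  have eps0 : 0 < eps by rewrite divr_gt0 // mulr_gt0.
  have seps0 : 0 < s - eps.
    by rewrite subr_gt0 /eps ltr_pdivrMr // ltr_pM2l //; lra.
  have sepsE : s + eps = (1 + e) * (s - eps).
    by rewrite /eps; field; rewrite gt_eqF.
  have [d d0 incr] := smooth_map_enorm_increment _ _ _ _ oO fs Ox eps0.
  apply: limf_esup_le_near; near=> r.
  have r0 : 0 < r by [].
  apply: (@dilatation_le _ _ _ _ _ _ _ (r * (s - eps))).
  + by rewrite mulr_gt0.
  + exists (enorm (f x - f (x + r *: delta_mx k0 0)))%:E.
    apply: sphere_dists_translate; rewrite ?enorm_delta ?ltW //.
    have [|//] := incr (r *: delta_mx k0 0).
    by rewrite enormZ enorm_delta mulr1 gtr0_norm.
  + move=> _ [y [Oy xy] <-]; have yx : enorm (y - x) = r.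
      by rewrite -enormN opprB.
    have [|_] := incr (y - x); first by rewrite yx.
    rewrite [x + _]addrC subrK As yx ler_distl !lee_fin.
    by rewrite mulrCA -sepsE [r * _]mulrC [r * _]mulrC mulrBl mulrDl.
Unshelve. all: end_near.
Qed.
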